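(* Let $\mathbf{a}=(a_n)_{n\geq0}$ be a $k$-automatic sequence of positive integers (for some $k\geq 2$). Write $\mathbf{a}=\varphi(\sigma^\infty(i))$ with $\sigma$ a $k$-uniform morphism on a finite alphabet $\mathcal{I}$, $i\in\mathcal{I}$ with $\sigma(i)$ beginning with $i$, and $\varphi$ a coding, and assume that the first letter $i$ of the internal sequence $\sigma^\infty(i)$ occurs at least twice in $\sigma^\infty(i)$. Then the real number $\xi=[a_0,a_1,a_2,\ldots]$ (continued fraction) is not a $U_2$-number.
   Context: A $k$-uniform morphism maps each letter to a word of length $k$; a coding is letter-to-letter (here with values in the positive integers, a finite set); $\sigma^\infty(i)=\lim_n\sigma^n(i)$. For real $\xi$ and $n\geq 1$, $w_n(\xi)$ is the supremum of the real $\omega$ such that infinitely many integer polynomials $P$ of degree at most $n$ satisfy $0<|P(\xi)|\leq H(P)^{-\omega}$, where $H(P)$ is the maximum absolute value of the coefficients. A real number $\xi$ is a $U_2$-number if $w_2(\xi)=+\infty$ and $w_1(\xi)<+\infty$. *)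

(* Defs.v *)
From HB Require Import structures.
From mathcomp Require Import all_boot all_order all_algebra.
From mathcomp Require Import all_classical all_reals all_analysis.

Set Implicit Arguments.
Unset Strict Implicit.
Unset Printing Implicit Defensive.

Import Order.TTheory GRing.Theory Num.Theory.
Import numFieldNormedType.Exports.

Local Open Scope classical_set_scope.
Local Open Scope ring_scope.

Section Words.
Local Open Scope nat_scope.

Definition base_value (k : nat) (w : seq 'I_k) : nat :=
  foldl (fun m (d : 'I_k) => m * k + d) 0 w.

(* Words without leading zero are exactly the base-k expansions of the natural
   numbers (most significant digit first); 0 is represented by the empty word. *)
Definition canonical_expansion (k : nat) (w : seq 'I_k) : bool :=
  if w is d :: _ then 0 < d else true.

(* a_n is the output of a finite automaton (states Q, initial state q0,
   transitions delta, outputs tau) reading the base-k expansion of n. *)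
Definition automatic (k : nat) (a : nat -> nat) : Prop :=
  exists (Q : finType) (q0 : Q) (delta : Q -> 'I_k -> Q) (tau : Q -> nat),
    forall w : seq 'I_k, canonical_expansion w ->
      a (base_value w) = tau (foldl delta q0 w).

Definition uniform_morphism (k : nat) (I : Type) (sigma : I -> seq I) : Prop :=
  forall x : I, size (sigma x) = k.

Definition apply_morphism (I : Type) (sigma : I -> seq I) (w : seq I) : seq I :=
  flatten (map sigma w).

(* u is the infinite word sigma^oo(i): every letter of sigma^m(i) is eventually
   defined and stationary as m grows, with limit the letter of u. *)
Definition morphic_limit (I : Type) (sigma : I -> seq I) (i : I)
    (u : nat -> I) : Prop :=
  forall n, exists M, forall m, M <= m ->
    onth (iter m (apply_morphism sigma) [:: i]) n = Some (u n).

End Words.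

Section ContinuedFractions.
Variable R : realType.

(* [a_0, a_1, ..., a_n], by [a_0, ..., a_n] = a_0 + 1 / [a_1, ..., a_n] *)
Fixpoint convergent (a : nat -> nat) (n : nat) : R :=
  if n is m.+1 then (a 0%N)%:R + (convergent (fun j => a j.+1) m)^-1
  else (a 0%N)%:R.

(* [a_0, a_1, a_2, ...]; the limit exists when the a_n are positive. *)
Definition cfrac (a : nat -> nat) : R := limn (convergent a).

End ContinuedFractions.

Section MahlerExponents.
Variable R : realType.

Definition height (P : {poly int}) : nat :=
  (\max_(j < size P) absz (P`_j)%R)%N.

Definition eval_at (P : {poly int}) (xi : R) : R :=
  (map_poly intr P : {poly R}).[xi].

Definition good_polys (n : nat) (xi omega : R) : set {poly int} :=
  [set P : {poly int} | [/\ (size P <= n.+1)%N, 0 < `|eval_at P xi| &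
               `|eval_at P xi| <= (height P)%:R `^ (- omega)]].

Definition w_exp (n : nat) (xi : R) : \bar R :=
  ereal_sup [set omega%:E | omega in
               [set omega : R | infinite_set (good_polys n xi omega)]].

Definition U2_number (xi : R) : Prop :=
  w_exp 2 xi = +oo%E /\ (w_exp 1 xi < +oo)%E.

End MahlerExponents.

(* Main.v *)
(** Let p > 0 be a second occurrence of i = u_0. Then u starts with W_n V_n where
    |W_n| = p k^n and V_n is the prefix of W_n of length k^n, so that xi is very
    close to the quadratic number alpha_n = [W_n W_n ...].  Let A be the leading
    coefficient of the integer quadratic polynomial of alpha_n.  The common prefix
    of xi and alpha_n has length (p + 1) k^n, hence A^2 |xi - alpha_n| is
    exponentially small in k^n, whereas Liouville gives |P(alpha_n)| >> 1 / (H A^2)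
    whenever P has degree at most 2, height H, and P(alpha_n) <> 0.  With n minimal
    such that exp(c k^n) exceeds H^2, this bounds |P(xi)| from below by a power of H,
    because A^2 <= exp(c' k^n).  If P(alpha_n) = 0, use alpha_(n + N) instead, with N
    a suitable constant: if P vanished there as well, then alpha_n = alpha_(n + N), so
    a prefix of the sequence much longer than its period p k^n would be periodic; by
    automaticity the whole sequence would be, giving xi = alpha_n and P(xi) = 0. *)
Require Import Defs.
From mathcomp Require Import all_boot all_order all_algebra.
From mathcomp Require Import all_classical all_reals all_analysis.
From mathcomp Require Import ring lra zify.

Set Implicit Arguments.
Unset Strict Implicit.
Unset Printing Implicit Defensive.

Import Order.TTheory GRing.Theory Num.Theory.
Import numFieldNormedType.Exports.

(** * Letters and blocks in fixed points of uniform morphisms *)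

Section AutomaticWords.
Local Open Scope nat_scope.

Lemma onth_apply_morphism (k : nat) (I : Type) (sigma : I -> seq I) (w : seq I)
    (j t : nat) (x : I) :
  uniform_morphism k sigma -> t < k -> onth w j = Some x ->
  onth (apply_morphism sigma w) (k * j + t) = onth (sigma x) t.
Proof.
move=> hk ht; elim: w j => [|y w IH] [|j] //= E.
- by case: E => <-; rewrite muln0 add0n /apply_morphism /= onth_cat hk ht.
- rewrite /apply_morphism /= onth_cat hk ifF; last by apply/negbTE; nia.
  by rewrite -(IH j E); congr (onth _ _); nia.
Qed.

(** Past a stage where positions [j] and [k * j + t] have both stabilised, one more application of
    [sigma] shows that [u] is a fixed point of [sigma]. *)
Lemma morphic_limit_step (k : nat) (I : Type) (sigma : I -> seq I) (i : I)
    (u : nat -> I) (j t : nat) :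
  uniform_morphism k sigma -> morphic_limit sigma i u -> t < k ->
  onth (sigma (u j)) t = Some (u (k * j + t)).
Proof.
move=> hk hu ht; have [M1 H1] := hu j; have [M2 H2] := hu (k * j + t).
rewrite -(H2 _ (leqW (leq_maxr M1 M2))) iterS.
by rewrite (onth_apply_morphism hk ht (H1 _ (leq_maxl _ _))).
Qed.

Lemma morphic_limit0 (I : Type) (sigma : I -> seq I) (i : I) (u : nat -> I) :
  ohead (sigma i) = Some i -> morphic_limit sigma i u -> u 0 = i.
Proof.
move=> hi /(_ 0) [M /(_ M (leqnn M))].
have -> : onth (iter M (apply_morphism sigma) [:: i]) 0 = Some i.
  elim: M => //= m; case: (iter m _ _) => // y w [->].
  by rewrite /apply_morphism /=; move: hi; case: (sigma i).
by case.
Qed.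

(* The only consequence of automaticity needed: equal letters of [u] expand
   to equal blocks at every scale [k ^ s]. *)
Definition block_determined (k : nat) (T : Type) (u : nat -> T) : Prop :=
  forall s x y t, u x = u y -> t < k ^ s -> u (k ^ s * x + t) = u (k ^ s * y + t).

Lemma morphic_limit_block_determined (k : nat) (I : Type) (sigma : I -> seq I)
    (i : I) (u : nat -> I) :
  0 < k -> uniform_morphism k sigma -> morphic_limit sigma i u ->
  block_determined k u.
Proof.
move=> k0 hk hu; elim=> [|s IH] x y t exy.
  by rewrite expn0 ltnS leqn0 !mul1n => /eqP ->; rewrite !addn0.
rewrite expnS => ht.
have ht' : t %/ k < k ^ s by rewrite ltn_divLR // mulnC.
(* The letter at this position is the [t %% k]-th letter of the image of its parent, to which the
   induction hypothesis applies. *)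
have E z : k * k ^ s * z + t = k * (k ^ s * z + t %/ k) + t %% k.
  by rewrite mulnDr mulnA -addnA (mulnC k (t %/ k)) -divn_eq.
apply: Some_inj; rewrite !E.
rewrite -!(morphic_limit_step _ hk hu) ?ltn_pmod //.
by rewrite (IH _ _ _ exy ht').
Qed.

(** [J] is the maximum, over the finitely many values, of a bound on one occurrence. It will be
    applied to pairs of consecutive letters. *)
Lemma ltn_first_occurrences (T : finType) (v : nat -> T) :
  exists J, forall x, exists2 y, y < J & v y = v x.
Proof.
have F (c : T) : {J | forall x, v x = c -> exists2 y, y < J & v y = c}.
  apply: cid; have [[x0 hx0]|h] := pselect (exists x, v x = c).
    by exists x0.+1 => _ _; exists x0.
  by exists 0 => x hx; case: h; exists x.
exists (\max_(c : T) sval (F c)) => x.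
have [y hy ey] := svalP (F (v x)) x erefl.
by exists y => //; apply: leq_trans hy (leq_bigmax _).
Qed.

(* Whether position [j] respects the period [r <= k ^ s] depends only on two
   consecutive letters of [u] at scale [k ^ s], and all such pairs occur early. *)
Lemma periodic_of_long_prefix (k : nat) (T : finType) (u : nat -> T)
    (phi : T -> nat) :
  0 < k -> block_determined k u ->
  exists J, forall s r, r <= k ^ s ->
    (forall j, j < k ^ s * J -> phi (u (j + r)) = phi (u j)) ->
    forall j, phi (u (j + r)) = phi (u j).
Proof.
move=> k0 hu; have [J hJ] := ltn_first_occurrences (fun x => (u x, u x.+1)).
exists J => s r hr H j.
have ks0 : 0 < k ^ s by rewrite expn_gt0 k0.
have [y hy [e1 e2]] := hJ (j %/ k ^ s).
have hm : j %% k ^ s < k ^ s by rewrite ltn_pmod.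
have Ej : j = k ^ s * (j %/ k ^ s) + j %% k ^ s by rewrite mulnC -divn_eq.
have A1 : u j = u (k ^ s * y + j %% k ^ s).
  by rewrite {1}Ej; apply: hu.
have A2 : u (j + r) = u (k ^ s * y + j %% k ^ s + r).
  (* As [r <= k ^ s], position [j + r] lies in the block of [j] or in the next one; the second
     component of the pair serves the latter case. *)
  have [lt|ge] := ltnP (j %% k ^ s + r) (k ^ s).
    rewrite {1}Ej -!addnA; exact: hu.
  have lt2 : j %% k ^ s + r - k ^ s < k ^ s by lia.
  have := hu s _ _ _ (esym e2) lt2.
  by rewrite !mulnS; congr (u _ = u _); lia.
rewrite A1 A2; apply: H.
by nia.
Qed.

End AutomaticWords.

(** * Integer quadratic polynomials with nonsquare discriminant *)

Section QuadraticIrrationals.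
Local Open Scope ring_scope.

Lemma sqr_of_sqr_mul (D v w : int) :
  v != 0 -> D * v ^+ 2 = w ^+ 2 -> exists s : int, s ^+ 2 = D.
Proof.
move=> v0 E.
have : (v ^+ 2 %| w ^+ 2)%Z by rewrite -E dvdz_mull.
rewrite dvdz_pexp2r // => /dvdzP[s Es]; exists s.
apply: (mulIf (expf_neq0 2 v0)).
by rewrite E Es exprMn.
Qed.

(** This is the discriminant of the characteristic polynomial of a matrix of trace [t] and
    determinant [e]. It lies strictly between consecutive squares: above [(t - 1) ^+ 2] and below
    [t ^+ 2] if [e = 1], above [t ^+ 2] and below [(t + 1) ^+ 2] if [e = -1] and [t > 1]; the
    remaining value is 5. *)
Lemma trace_disc_nonsquare (t e s : int) :
  e = 1 /\ 3%:Z <= t \/ e = -1 /\ 1 <= t -> s ^+ 2 != t ^+ 2 - 4%:Z * e.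
Proof.
wlog s0 : s / 0 <= s => [W|].
  have [/W//|s0] := lerP 0 s; rewrite -sqrrN; apply: W; lia.
move=> h; apply/eqP; rewrite !expr2 => E.
case: h => -[ee ht]; subst e.
- have [ts|st] := lerP t s; first by have := ler_pM (le_trans _ ht) (le_trans _ ht) ts ts; lia.
  have st1 : s <= t - 1 by lia.
  by have := ler_pM s0 s0 st1 st1; lia.
- have [st|ts] := lerP s t; first by have := ler_pM s0 s0 st st; lia.
  have st1 : t + 1 <= s by lia.
  have t0 : 0 <= t + 1 by lia.
  have t1 : t = 1 by have := ler_pM t0 t0 st1 st1; lia.
  subst t; have [s2|s3] := lerP s 2; first by have := ler_pM s0 s0 s2 s2; lia.
  have {}s3 : 3 <= s by lia.
  by have := ler_pM (isT : 0 <= 3 :> int) (isT : 0 <= 3 :> int) s3 s3; lia.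
Qed.

(** Eliminating [y ^+ 2] leaves [U * y + V = 0]. If [U] were nonzero, [y] would be rational and the
    discriminant a square. *)
Lemma common_root_proportional (R : realFieldType) (A B C a b c : int) (y : R) :
  (forall s : int, s ^+ 2 != B ^+ 2 - 4%:Z * (A * C)) ->
  A%:~R * y ^+ 2 + B%:~R * y + C%:~R = 0 ->
  a%:~R * y ^+ 2 + b%:~R * y + c%:~R = 0 ->
  A * b = a * B /\ A * c = a * C.
Proof.
move=> nsq EA Ea.
pose U := A * b - a * B; pose V := A * c - a * C.
have EU : U%:~R * y + V%:~R = 0 :> R.
  rewrite /U /V !rmorphB !rmorphM /=.
  transitivity (A%:~R * (a%:~R * y ^+ 2 + b%:~R * y + c%:~R)
    - a%:~R * (A%:~R * y ^+ 2 + B%:~R * y + C%:~R)); first by ring.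
  by rewrite EA Ea; ring.
have [U0|U0] := eqVneq U 0.
  move: EU; rewrite U0 mul0r add0r => /eqP; rewrite intr_eq0 => /eqP V0.
  by move: U0 V0; rewrite /U /V => /eqP; rewrite subr_eq0 => /eqP -> /eqP;
     rewrite subr_eq0 => /eqP ->.
move: U V U0 EU => U V U0 EU.
have [s Es] : exists s : int, s ^+ 2 = B ^+ 2 - 4%:Z * (A * C).
  (* Since [V = - U * y], the witness is [- U * (2 * A * y + B)], and [2 * A * y + B] is a square
     root of the discriminant. *)
  apply: (@sqr_of_sqr_mul _ U (2%:Z * A * V - B * U)) => //.
  apply/eqP; rewrite -subr_eq0 -(intr_eq0 R); apply/eqP.
  rewrite !(rmorphB, rmorphM, rmorphXn) /=.
  have -> : V%:~R = - (U%:~R * y) :> R by apply/eqP; rewrite -addr_eq0 addrC EU.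
  transitivity (- 4%:R * A%:~R * U%:~R ^+ 2 *
    (A%:~R * y ^+ 2 + B%:~R * y + C%:~R)); first by ring.
  by rewrite EA mulr0.
by have := nsq s; rewrite Es eqxx.
Qed.

(* Liouville's inequality: [A ^ 2 * P(y) * P(y')] is a nonzero integer, being
   the norm of [A * P(y)]. *)
Lemma quadratic_norm_ge1 (R : realFieldType) (A B C a b c : int) (y y' : R) :
  A != 0 ->
  (forall s : int, s ^+ 2 != B ^+ 2 - 4%:Z * (A * C)) ->
  A%:~R * (y + y') = - B%:~R -> A%:~R * (y * y') = C%:~R ->
  a%:~R * y ^+ 2 + b%:~R * y + c%:~R != 0 ->
  1 <= A%:~R ^+ 2 * `|a%:~R * y ^+ 2 + b%:~R * y + c%:~R|
       * `|a%:~R * y' ^+ 2 + b%:~R * y' + c%:~R|.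
Proof.
move=> A0 nsq ES EP Py.
have AR0 : A%:~R != 0 :> R by rewrite intr_eq0.
have rooty : A%:~R * y ^+ 2 + B%:~R * y + C%:~R = 0.
  by rewrite -EP -[B%:~R]opprK -ES; ring.
have rooty' : A%:~R * y' ^+ 2 + B%:~R * y' + C%:~R = 0.
  by rewrite -EP -[B%:~R]opprK -ES; ring.
(* Vanishing at the conjugate would make the two polynomials proportional, hence force vanishing at
   [y]. *)
have Py' : a%:~R * y' ^+ 2 + b%:~R * y' + c%:~R != 0.
  apply: contra_neq Py => Py'.
  have [e1 e2] := common_root_proportional nsq rooty' Py'.
  apply: (mulfI AR0).
  rewrite !mulrDr mulr0 !mulrA -!rmorphM e1 e2 !rmorphM /=.
  transitivity (a%:~R * (A%:~R * y ^+ 2 + B%:~R * y + C%:~R)); first by ring.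
  by rewrite rooty mulr0.
(* [N] is the resultant of the two quadratic polynomials. *)
pose N : int := a ^+ 2 * C ^+ 2 - a * b * C * B
  + a * c * (B ^+ 2 - 2%:Z * (A * C)) + b ^+ 2 * (A * C)
  - b * c * (B * A) + c ^+ 2 * A ^+ 2.
have EN : N%:~R = A%:~R ^+ 2 * (a%:~R * y ^+ 2 + b%:~R * y + c%:~R)
    * (a%:~R * y' ^+ 2 + b%:~R * y' + c%:~R).
  rewrite /N !(rmorphD, rmorphN, rmorphM, rmorphXn) /=.
  by rewrite -EP -[B%:~R]opprK -ES; ring.
have N0 : N != 0 by rewrite -(intr_eq0 R) EN !mulf_neq0 ?expf_neq0.
have -> : A%:~R ^+ 2 = `|A%:~R ^+ 2| :> R by rewrite ger0_norm ?sqr_ge0.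
by rewrite -!normrM -EN -intr_norm ler1z; lia.
Qed.

End QuadraticIrrationals.

(** * Continuants, complete quotients and Liouville's argument *)

Section CompleteQuotients.
Local Open Scope ring_scope.

(* [p / q] and [p' / q'] are consecutive convergents of [a_0, a_1, ...]. *)
Lemma continuants (R : realFieldType) (a : nat -> nat) (r : nat) :
  (forall j, (0 < a j)%N) -> (2 <= r)%N ->
  exists p p' q q' : nat,
    [/\ [/\ (2 <= p)%N, (1 <= q')%N, (p' <= p)%N & (q' <= q)%N],
        ((p * q')%:Z - (p' * q)%:Z = 1 \/ (p * q')%:Z - (p' * q)%:Z = -1) &
        forall x : nat -> R, (forall j, 0 < x j) ->
          (forall j, (j < r)%N -> x j = (a j)%:R + (x j.+1)^-1) ->
          x 0%N * (q%:R * x r + q'%:R) = p%:R * x r + p'%:R /\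
          q%:R * x r + q'%:R = \prod_(1 <= j < r.+1) x j].
Proof.
move=> a0; elim: r => // r IH; rewrite leq_eqVlt => /predU1P[<-|].
  (* The induction starts at [r = 2] because [2 <= p] and [1 <= q'] can fail for [r = 1]. *)
  exists (a 0 * a 1 + 1)%N, (a 0%N), (a 1%N), 1%N; split; [split| |].
  - by have := a0 0%N; have := a0 1%N; nia.
  - by [].
  - by have := a0 0%N; have := a0 1%N; nia.
  - exact: a0.
  - by left; lia.
  move=> x x0 xr.
  rewrite big_nat_recr //= big_nat1 (xr 0%N) // (xr 1%N) //.
  have x2 := x0 2%N; have x1 := x0 1%N; rewrite (xr 1%N) // in x1.
  move: (x 2%N) x2 x1 => z z0 z1.
  have h : (a 1)%:R * z + 1 != 0.
    rewrite gt_eqF // ltr_wpDl // mulr_ge0 ?ler0n //; exact: ltW.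
  rewrite natrD natrM; split; field; rewrite ?h ?andbT ?gt_eqF //.
rewrite ltnS => /IH[p [p' [q [q' [[h1 h2 h3 h4] hd hx]]]]].
exists (p * a r + p')%N, p, (q * a r + q')%N, q; split; [split| |].
- by have := a0 r; nia.
- by lia.
- by have := a0 r; nia.
- by have := a0 r; nia.
- by case: hd => hd; [right|left]; rewrite !PoszM !PoszD !PoszM in hd *; lia.
move=> x x0 xr.
have [e1 e2] := hx x x0 (fun j hj => xr j (leqW hj)).
have er := xr r (ltnSn r).
have xr0 : x r.+1 != 0 by rewrite gt_eqF.
rewrite (@big_nat_recr _ _ _ r.+1) //= -e2 !natrD !natrM.
have Eq z w : z%:R * x r * x r.+1 + w * x r.+1 =
    (z%:R * (a r)%:R + w) * x r.+1 + z%:R :> R.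
  by rewrite er; field.
split; last by rewrite -Eq; ring.
by rewrite -!Eq -!mulrDl mulrA e1.
Qed.

(** A common partial quotient cancels in [x j - y j], leaving the next difference, up to sign,
    divided by [x j.+1 * y j.+1]; iterating gives an exact identity. *)
Lemma common_prefix_dist (R : realFieldType) (a : nat -> nat) (L : nat)
    (x y : nat -> R) :
  (forall j, 0 < x j) -> (forall j, 0 < y j) ->
  (forall j, (j < L)%N -> x j = (a j)%:R + (x j.+1)^-1) ->
  (forall j, (j < L)%N -> y j = (a j)%:R + (y j.+1)^-1) ->
  `|x 0%N - y 0%N| * \prod_(1 <= j < L.+1) (x j * y j) = `|x L - y L|.
Proof.
move=> x0 y0; elim: L => [|L IH] ex ey.
  by rewrite big_geq // mulr1.
rewrite (@big_nat_recr _ _ _ L.+1) //= [LHS]mulrA.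
rewrite IH => [|j hj|j hj]; [|exact/ex/leqW|exact/ey/leqW].
rewrite (ex L) // (ey L) //.
have := x0 L.+1; have := y0 L.+1; move: (x L.+1) (y L.+1) => z w w0 z0.
have -> : z * w = `|z * w| by rewrite gtr0_norm // mulr_gt0.
by rewrite -normrM distrC; congr `|_|; field; rewrite !gt_eqF.
Qed.

(* If [y] is purely periodic, [y_0] is a root of [q X^2 + (q' - p) X - p'],
   whose discriminant is [(p + q')^2 -+ 4] and whose other root is in [-1, 0]. *)
Lemma purely_periodic_quadratic (R : realFieldType) (a : nat -> nat) (r : nat) :
  (forall j, (0 < a j)%N) -> (2 <= r)%N ->
  exists A B C : int,
    [/\ 0 < A, C <= 0, (forall s : int, s ^+ 2 != B ^+ 2 - 4%:Z * (A * C)),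
     (forall x : nat -> R, (forall j, 0 < x j) ->
        (forall j, (j < r)%N -> x j = (a j)%:R + (x j.+1)^-1) ->
        A%:~R <= \prod_(1 <= j < r) x j) &
     (forall y : nat -> R, (forall j, 0 < y j) ->
        (forall j, (j < r)%N -> y j = (a j)%:R + (y j.+1)^-1) -> y r = y 0%N ->
        exists y' : R, [/\ A%:~R * (y 0%N + y') = - B%:~R,
          A%:~R * (y 0%N * y') = C%:~R & `|y'| <= 1])].
Proof.
move=> a0 r2; have [p [p' [q [q' [[h1 h2 h3 h4] hd hx]]]]] := @continuants R a r a0 r2.
exists q%:Z, (q'%:Z - p%:Z), (- p'%:Z); split.
- by lia.
- by lia.
- move=> s.
  have -> : (q'%:Z - p%:Z) ^+ 2 - 4%:Z * (q%:Z * - p'%:Z) =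
    (p%:Z + q'%:Z) ^+ 2 - 4%:Z * ((p * q')%:Z - (p' * q)%:Z).
    by rewrite !PoszM; ring.
  apply: trace_disc_nonsquare; case: hd => ->; [left|right]; split=> //; lia.
(* The product up to [x r] equals [q * x r + q']; drop [q'] and cancel [x r]. *)
- move=> x x0 xr; have [_] := hx x x0 xr.
  rewrite big_nat_recr /=; last by lia.
  move=> E; rewrite -(ler_pM2r (x0 r)) -E lerDl ler0n //.
move=> y y0 yr yp; have [] := hx y y0 yr; rewrite yp => E _.
have q0 : 0 < q%:R :> R by rewrite ltr0n; lia.
have := y0 0%N; move: (y 0%N) E => z E z0.
have {}E : q%:R * z ^+ 2 + (q'%:R - p%:R) * z - p'%:R = 0.
  by apply/eqP; rewrite subr_eq0; apply/eqP; nra.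
(* The conjugate, read off from the product [- p' / q] of the roots, agrees with the one given by
   their sum. *)
have Ez : - (p'%:R / (q%:R * z)) = (p%:R - q'%:R) / q%:R - z.
  apply/eqP; rewrite -subr_eq0; apply/eqP.
  transitivity ((q%:R * z ^+ 2 + (q'%:R - p%:R) * z - p'%:R) / (q%:R * z)).
    by field; rewrite !gt_eqF.
  by rewrite E mul0r.
exists (- (p'%:R / (q%:R * z))); split.
- rewrite Ez rmorphB /= -!pmulrn; field; by rewrite gt_eqF.
- by rewrite rmorphN /= -!pmulrn; field; rewrite !gt_eqF.
rewrite normrN ger0_norm ?divr_ge0 ?ler0n // ?mulr_ge0 ?ler0n ?(ltW z0) //.
have E2 : p'%:R / (q%:R * z) * (q%:R * (p'%:R / (q%:R * z)) + p%:R - q'%:R) = p'%:R.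
  have -> : q%:R * (p'%:R / (q%:R * z)) + p%:R - q'%:R = q%:R * z.
    rewrite (oppr_inj (etrans Ez (esym (opprB _ _)))).
    by field; rewrite gt_eqF.
  by field; rewrite !gt_eqF.
have w0 : 0 <= p'%:R / (q%:R * z).
  by rewrite divr_ge0 ?ler0n // mulr_ge0 ?ler0n // ltW.
move: (p'%:R / (q%:R * z)) E2 w0 => w E2 w0.
(* If [w > 1], then [q * w >= q'], so [E2] yields [w * p <= p' <= p], which is absurd. *)
have [//|w1] := lerP w 1.
have hqq : q'%:R <= q%:R :> R by rewrite ler_nat.
have hpp : p'%:R <= p%:R :> R by rewrite ler_nat.
have hp : 0 < p%:R :> R by rewrite ltr0n; lia.
have : w * p%:R <= p'%:R.
  rewrite -[leRHS]E2; apply: ler_wpM2l => //; nra.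
nra.
Qed.

(* A continued fraction and a purely periodic one sharing [L] partial quotients:
   the gap [L - r] beyond the period [r] gains a factor [rho ^ (L - r)] over
   [A ^ -2], which beats Liouville's bound. *)
Lemma quadratic_value_lower_bound (R : realFieldType) (a : nat -> nat) (r L : nat)
    (x y : nat -> R) (m rho H : R) (b c d : int) :
  (forall j, (0 < a j)%N) -> (2 <= r)%N -> (r <= L)%N -> 1 <= rho ->
  (forall j, rho <= x j <= m) -> (forall j, rho <= y j <= m) ->
  (forall j, (j < L)%N -> x j = (a j)%:R + (x j.+1)^-1) ->
  (forall j, (j < L)%N -> y j = (a j)%:R + (y j.+1)^-1) -> y r = y 0%N ->
  0 <= H -> `|b%:~R| <= H -> `|c%:~R| <= H -> `|d%:~R| <= H ->
  b%:~R * y 0%N ^+ 2 + c%:~R * y 0%N + d%:~R != 0 ->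
  6%:R * (m * (2%:R * m + 1)) * H ^+ 2 <= rho ^+ (L - r) ->
  1 <= 6%:R * H * m ^+ (2 * r) *
       `|b%:~R * x 0%N ^+ 2 + c%:~R * x 0%N + d%:~R|.
Proof.
move=> a0 r2 rL rho1 hx hy ex ey yp H0 hb hc hd Py big.
have x0 j : 0 < x j by case/andP: (hx j) => h _; lra.
have y0 j : 0 < y j by case/andP: (hy j) => h _; lra.
have ex' j : (j < r)%N -> x j = (a j)%:R + (x j.+1)^-1.
  by move=> hj; apply/ex/(leq_trans hj).
have ey' j : (j < r)%N -> y j = (a j)%:R + (y j.+1)^-1.
  by move=> hj; apply/ey/(leq_trans hj).
have [A [B [C [A0 C0 nsq hA hconj]]]] := @purely_periodic_quadratic R a r a0 r2.
have [y' [eS eP y'1]] := hconj y y0 ey' yp.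
have An0 : A != 0 by rewrite gt_eqF.
have N1 := quadratic_norm_ge1 An0 nsq eS eP Py.
have AR : 0 < A%:~R :> R by rewrite ltr0z.
have Ax := hA x x0 ex'; have Ay := hA y y0 ey'.
have m1 : 1 <= m by have := hx 0%N => /andP[]; lra.
have Am : A%:~R ^+ 2 <= m ^+ (2 * r).
  rewrite mulnC exprM; apply: lerXn2r; rewrite ?nnegrE ?exprn_ge0 //; try lra.
  apply: le_trans Ax _.
  apply: (@le_trans _ _ (\prod_(1 <= j < r) m)).
    by apply: ler_prod => j _; rewrite (ltW (x0 j)); case/andP: (hx j).
  rewrite big_const_nat iter_mulr_1; apply: ler_weXn2l => //; exact: leq_subr.
have Py'b : `|b%:~R * y' ^+ 2 + c%:~R * y' + d%:~R| <= 3%:R * H.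
  apply: le_trans (ler_normD _ _) _; apply: le_trans (lerD (ler_normD _ _) (lexx _)) _.
  rewrite [in leLHS]normrM normrX normrM.
  have h0 := normr_ge0 y'.
  have h1 : `|b%:~R| * `|y'| ^+ 2 <= H.
    rewrite -[leRHS]mulr1; apply: ler_pM => //; rewrite ?exprn_ge0 //.
    by rewrite expr2; nra.
  have h2 : `|c%:~R| * `|y'| <= H.
    by rewrite -[leRHS]mulr1; apply: ler_pM.
  lra.
(* As [y'] has absolute value at most 1, the conjugate factor of the norm is at most [3 * H]. *)
have N3 : 1 <= 3%:R * H * A%:~R ^+ 2 * `|b%:~R * y 0%N ^+ 2 + c%:~R * y 0%N + d%:~R|.
  apply: le_trans N1 _; rewrite [leRHS](_ : _ = A%:~R ^+ 2 *
    `|b%:~R * y 0%N ^+ 2 + c%:~R * y 0%N + d%:~R| * (3%:R * H)); last by ring.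
  by apply: ler_wpM2l => //; rewrite mulr_ge0 ?sqr_ge0.
have dist := common_prefix_dist x0 y0 ex ey.
(* The product is cut at [r]: the factors before it contribute at least [A ^+ 2], those from [r] to
   [L - 1] at least [rho] each, and the last at least 1. *)
have dxy : A%:~R ^+ 2 * `|x 0%N - y 0%N| * rho ^+ (L - r) <= m.
  apply: (@le_trans _ _ `|x L - y L|); last first.
    by case/andP: (hx L) => ? ?; case/andP: (hy L) => ? ?; rewrite ler_norml; lra.
  rewrite -dist (@big_cat_nat _ _ _ r) //=; [|exact: ltnW|exact: leqW].
  rewrite (mulrC (A%:~R ^+ 2)) -mulrA; apply: ler_wpM2l => //.
  apply: ler_pM; rewrite ?sqr_ge0 ?exprn_ge0 //; first lra.
    by rewrite big_split /= expr2; apply: ler_pM; rewrite ?(ltW AR).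
  have -> : rho ^+ (L - r) = \prod_(r <= j < L) rho.
    by rewrite big_const_nat iter_mulr_1.
  rewrite big_nat_recr //=.
  rewrite -[leLHS]mulr1; apply: ler_pM.
  - by apply: prodr_ge0 => j _; lra.
  - by [].
  - apply: ler_prod => j _; case/andP: (hx j) => ? ?; case/andP: (hy j) => ? ?.
    by apply/andP; split; nra.
  - by case/andP: (hx L) => ? ?; case/andP: (hy L) => ? ?; nra.
have PP : `|(b%:~R * y 0%N ^+ 2 + c%:~R * y 0%N + d%:~R)
    - (b%:~R * x 0%N ^+ 2 + c%:~R * x 0%N + d%:~R)| <=
    `|x 0%N - y 0%N| * (H * (2%:R * m + 1)).
  rewrite (_ : _ - _ = (y 0%N - x 0%N) * (b%:~R * (x 0%N + y 0%N) + c%:~R)); last by ring.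
  rewrite normrM distrC; apply: ler_wpM2l => //.
  apply: le_trans (ler_normD _ _) _; rewrite [leRHS]mulrDr [X in _ <= _ + X]mulr1; apply: lerD => //.
  rewrite normrM; apply: ler_pM => //.
  have := x0 0%N; have := y0 0%N; case/andP: (hx 0%N) => ? ?; case/andP: (hy 0%N) => ? ? ? ?.
  by rewrite gtr0_norm; lra.
move: N3 PP.
set Vy := (X in `|X|) in N1 *; rewrite -/Vy; set Vx := (X in `|Vy - X|).
move=> N3 PP.
have tri : `|Vy| <= `|Vx| + `|Vy - Vx|.
  by rewrite -[X in `|X| <= _](subrK Vx) addrC ler_normD.
have rp : 1 <= rho ^+ (L - r) by apply: exprn_ege1.
(* Doubling [N3] gives a lower bound 2 for the same multiple of the value at [y], so the value at
   [x] keeps at least 1. In [big], [m] comes from [dxy] and [2 * m + 1] from [PP]. *)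
have small : 6%:R * H * A%:~R ^+ 2 * `|Vy - Vx| <= 1.
  have rp0 : 0 < rho ^+ (L - r) by lra.
  rewrite -(ler_pM2r rp0) mul1r; apply: le_trans big.
  apply: (@le_trans _ _ (6%:R * H * (H * (2%:R * m + 1)) *
     (A%:~R ^+ 2 * `|x 0%N - y 0%N| * rho ^+ (L - r)))).
    rewrite [leRHS](_ : _ = 6%:R * H * A%:~R ^+ 2 *
      (`|x 0%N - y 0%N| * (H * (2%:R * m + 1))) * rho ^+ (L - r)); last by ring.
    apply: ler_wpM2r; first lra.
    by apply: ler_wpM2l => //; rewrite !mulr_ge0 // ?exprn_ge0 // ltW.
  rewrite [leRHS](_ : _ = 6%:R * H * (H * (2%:R * m + 1)) * m); last by ring.
  by apply: ler_wpM2l => //; rewrite !mulr_ge0 //; lra.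
apply: (@le_trans _ _ (6%:R * H * A%:~R ^+ 2 * `|Vx|)).
  have h := ler_wpM2l (_ : 0 <= 6%:R * H * A%:~R ^+ 2) tri.
  have {}h := h ltac:(by rewrite !mulr_ge0 // ?exprn_ge0 // ltW).
  rewrite mulrDr in h; lra.
apply: ler_wpM2r => //; apply: ler_wpM2l => //; by rewrite mulr_ge0.
Qed.

(** The polynomial is proportional to the quadratic of [y 0], whose roots have product [C / A <= 0];
    two distinct positive roots are impossible. *)
Lemma purely_periodic_root_unique (R : realFieldType) (a : nat -> nat) (r : nat)
    (y : nat -> R) (z : R) (b c d : int) :
  (forall j, (0 < a j)%N) -> (2 <= r)%N -> (forall j, 0 < y j) ->
  (forall j, (j < r)%N -> y j = (a j)%:R + (y j.+1)^-1) -> y r = y 0%N -> 0 < z ->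
  b%:~R * y 0%N ^+ 2 + c%:~R * y 0%N + d%:~R = 0 ->
  b%:~R * z ^+ 2 + c%:~R * z + d%:~R = 0 ->
  [\/ b != 0, c != 0 | d != 0] ->
  z = y 0%N.
Proof.
move=> a0 r2 y0 yr yp z0 Py Pz nz.
have [A [B [C [A0 C0 nsq _ hconj]]]] := @purely_periodic_quadratic R a r a0 r2.
have [y' [eS eP _]] := hconj y y0 yr yp.
have rooty : A%:~R * y 0%N ^+ 2 + B%:~R * y 0%N + C%:~R = 0.
  by rewrite -eP -[B%:~R]opprK -eS; ring.
have [e1 e2] := common_root_proportional nsq rooty Py.
have An0 : A != 0 by rewrite gt_eqF.
have b0 : b != 0.
  apply/eqP => b0; move/eqP: e1; move/eqP: e2; rewrite b0 !mul0r !mulf_eq0.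
  rewrite (negPf An0) /= => /eqP d0 /eqP c0.
  by move: nz; rewrite b0 c0 d0 eqxx; case.
have rootz : A%:~R * z ^+ 2 + B%:~R * z + C%:~R = 0.
  have bR : b%:~R != 0 :> R by rewrite intr_eq0.
  apply: (mulfI bR); rewrite mulr0 !mulrDr !mulrA -!rmorphM -e1 -e2 !rmorphM /=.
  transitivity (A%:~R * (b%:~R * z ^+ 2 + c%:~R * z + d%:~R)); first by ring.
  by rewrite Pz mulr0.
have AR : 0 < A%:~R :> R by rewrite ltr0z.
have CR : C%:~R <= 0 :> R by rewrite lerz0.
have := y0 0%N; move: (y 0%N) rooty => w rooty w0.
have : (z - w) * (A%:~R * (z + w) + B%:~R) = 0.
  transitivity ((A%:~R * z ^+ 2 + B%:~R * z + C%:~R)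
     - (A%:~R * w ^+ 2 + B%:~R * w + C%:~R)); first by ring.
  by rewrite rooty rootz subrr.
move/eqP; rewrite mulf_eq0 subr_eq0 => /orP[/eqP//|/eqP eB].
have : A%:~R * (z * w) = C%:~R.
  have -> : C%:~R = - (A%:~R * z ^+ 2 + B%:~R * z) :> R by lra.
  have -> : B%:~R = - (A%:~R * (z + w)) :> R by lra.
  ring.
have : 0 < A%:~R * (z * w) by rewrite !mulr_gt0.
lra.
Qed.

End CompleteQuotients.

(** * Convergence and injectivity for bounded partial quotients *)

Section CfracTheory.
Local Open Scope classical_set_scope.
Local Open Scope ring_scope.

Lemma expr_unbounded (R : realType) (rho B : R) :
  1 < rho -> exists n, B <= rho ^+ n.
Proof.
move=> h; have bernoulli n : 1 + n%:R * (rho - 1) <= rho ^+ n.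
  elim: n => [|n IH]; first by rewrite mul0r addr0 expr0.
  rewrite exprS -(@natr1 _ n); have r0 : 0 <= rho by lra.
  have := mulr_ge0 (ler0n R n) (sqr_ge0 (rho - 1)).
  by have := ler_wpM2l r0 IH; rewrite expr2; lra.
have d0 : 0 < rho - 1 by lra.
exists (Num.bound `|B / (rho - 1)|); apply: le_trans (bernoulli _).
have := le_trans (ler_norm _) (ltW (archi_boundP (normr_ge0 (B / (rho - 1))))).
by rewrite ler_pdivrMr //; lra.
Qed.

Definition bounded_by (M : nat) (a : nat -> nat) := forall j, (0 < a j <= M)%N.

Lemma bounded_by_shift (M : nat) (a : nat -> nat) (n : nat) :
  bounded_by M a -> bounded_by M (fun j => a (n + j)%N).
Proof. by move=> h j; apply: h. Qed.

Lemma convergent_bounds (R : realType) (M : nat) (a : nat -> nat) (n : nat) :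
  bounded_by M a -> 1 <= convergent R a n <= M%:R + 1.
Proof.
elim: n a => [|n IH] a ha /=; have /andP[h1 h2] := ha 0%N.
  by rewrite ler1n h1 /= -[leLHS]addr0 lerD // ler_nat.
have /andP[v1 _] := IH _ (bounded_by_shift 1 ha).
move: h1 h2; rewrite -(ler1n R) -(ler_nat R) => h1 h2.
move: v1; rewrite /= => v1; set v := convergent _ _ _ in v1 *.
have v0 : 0 < v by lra.
have : v^-1 <= 1 by rewrite invf_le1.
have : 0 < v^-1 by rewrite invr_gt0.
by move=> ? ?; apply/andP; split; lra.
Qed.

(** The tail is at most [M + 1], so its inverse adds a fixed amount to [a 0 >= 1]. This is the
    expansion rate, greater than 1, used below. *)
Lemma convergentS_ge (R : realType) (M : nat) (a : nat -> nat) (n : nat) :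
  bounded_by M a -> 1 + (M%:R + 1)^-1 <= convergent R a n.+1.
Proof.
move=> ha; have /andP[h1 _] := ha 0%N.
have /andP[v1 vM] := convergent_bounds R n (bounded_by_shift 1 ha).
rewrite /= lerD ?ler1n // lef_pV2 ?posrE //; exact: lt_le_trans v1.
Qed.

(** Removing one partial quotient divides the distance by a product of two tails, each at least the
    rate of [convergentS_ge]; the successors in the indices make that bound available. *)
Lemma convergent_dist (R : realType) (M : nat) (a : nat -> nat) (L n m : nat) :
  bounded_by M a ->
  `|convergent R a (L + n).+1 - convergent R a (L + m).+1|
    * (1 + (M%:R + 1)^-1) ^+ L <= M%:R.
Proof.
elim: L a => [|L IH] a ha.
  rewrite expr0 mulr1 !add0n.
  have /andP[? ?] := convergent_bounds R n.+1 ha.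
  have /andP[? ?] := convergent_bounds R m.+1 ha.
  by rewrite ler_norml; apply/andP; split; lra.
have {}IH := IH _ (bounded_by_shift 1 ha).
have hv := convergentS_ge R (L + n) (bounded_by_shift 1 ha).
have hw := convergentS_ge R (L + m) (bounded_by_shift 1 ha).
rewrite !addSn; change (fun j => a (1 + j)%N) with (fun j => a j.+1) in IH, hv, hw.
change (convergent R a (L + n).+2) with
  ((a 0%N)%:R + (convergent R (fun j => a j.+1) (L + n).+1)^-1).
change (convergent R a (L + m).+2) with
  ((a 0%N)%:R + (convergent R (fun j => a j.+1) (L + m).+1)^-1).
move: (convergent R _ (L + n).+1) (convergent R _ (L + m).+1) IH hv hw => v w IH hv hw.
set rho := 1 + _ in IH hv hw *.
have rho1 : 1 <= rho by rewrite lerDl invr_ge0 addr_ge0.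
have v0 : 0 < v by lra.
have w0 : 0 < w by lra.
apply: le_trans IH; rewrite exprS mulrA; apply: ler_wpM2r.
  by rewrite exprn_ge0 //; lra.
have -> : (a 0%N)%:R + v^-1 - ((a 0%N)%:R + w^-1) = (w - v) / (v * w).
  by field; rewrite !gt_eqF.
rewrite normrM distrC normfV (gtr0_norm (mulr_gt0 v0 w0)).
rewrite -mulrA -[leRHS]mulr1; apply: ler_wpM2l => //.
rewrite mulrC ler_pdivrMr ?mulr_gt0 // mul1r; nra.
Qed.

Lemma cvg_convergent (R : realType) (M : nat) (a : nat -> nat) :
  bounded_by M a -> cvgn (convergent R a).
Proof.
move=> ha; apply/cauchy_cvgP; apply/cauchy_exP => e e0.
have rho1 : 1 < 1 + (M%:R + 1)^-1 :> R by rewrite ltrDl invr_gt0 ltr_wpDl.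
have [L hL] := expr_unbounded ((M%:R + 1) / e) rho1.
exists (convergent R a (L + 0).+1); exists L.+1 => // n /= hn.
rewrite -ball_normE /=.
have := convergent_dist R L 0 (n - L.+1) ha.
rewrite -[(L + (n - _)).+1]addSn subnKC //.
set rho := 1 + _ in rho1 hL *; have r0 : 0 < rho ^+ L by rewrite exprn_gt0; lra.
move: hL; rewrite ler_pdivrMr // => hL dL.
rewrite -(ltr_pM2r r0); apply: (le_lt_trans dL); lra.
Qed.

Lemma cfracS (R : realType) (M : nat) (a : nat -> nat) :
  bounded_by M a ->
  cfrac R a = (a 0%N)%:R + (cfrac R (fun j => a j.+1))^-1.
Proof.
move=> ha; have ha1 := bounded_by_shift 1 ha.
apply/cvg_lim => //; rewrite -cvg_shiftS /=.
have h1 := @cvg_convergent R M _ ha1.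
apply: cvgD; first exact: cvg_cst.
apply: cvgV; last exact: h1.
rewrite gt_eqF // (@lt_le_trans _ _ 1) //.
apply: limr_ge => //; near=> n.
by have /andP[] := convergent_bounds R n ha1.
Unshelve. all: by end_near. Qed.

Lemma cfrac_bounds (R : realType) (M : nat) (a : nat -> nat) :
  bounded_by M a -> 1 + (M%:R + 1)^-1 <= cfrac R a <= M%:R + 1.
Proof.
move=> ha; have h := @cvg_convergent R M _ ha; apply/andP; split.
  apply: limr_ge => //; exists 1%N => // -[//|n] _; exact: convergentS_ge.
apply: limr_le => //; near=> n; by have /andP[] := convergent_bounds R n ha.
Unshelve. all: by end_near. Qed.

(** Tails strictly exceed 1, so the head is the integer part. *)
Lemma cfrac_head_tail_inj (R : realType) (M : nat) (a b : nat -> nat) :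
  bounded_by M a -> bounded_by M b -> cfrac R a = cfrac R b ->
  a 0%N = b 0%N /\ cfrac R (fun j => a j.+1) = cfrac R (fun j => b j.+1).
Proof.
move=> ha hb; rewrite (cfracS R ha) (cfracS R hb).
have /andP[sa _] := cfrac_bounds R (bounded_by_shift 1 ha).
have /andP[sb _] := cfrac_bounds R (bounded_by_shift 1 hb).
have i0 : 0 < (M%:R + 1)^-1 :> R by rewrite invr_gt0 ltr_wpDl.
move: sa sb; rewrite /=.
move: (cfrac R (fun j => a j.+1)) (cfrac R (fun j => b j.+1)) => s t sa sb E.
have E0 : a 0%N = b 0%N.
  have : s^-1 < 1 by rewrite invf_lt1; lra.
  have : 0 < s^-1 by rewrite invr_gt0; lra.
  have : t^-1 < 1 by rewrite invf_lt1; lra.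
  have : 0 < t^-1 by rewrite invr_gt0; lra.
  by case: (ltngtP (a 0%N) (b 0%N)) => [||//]; rewrite -(ler_nat R) -natr1 => *;
     exfalso; lra.
by split=> //; move: E; rewrite E0 => /addrI/invr_inj.
Qed.

Lemma cfrac_inj (R : realType) (M : nat) (a b : nat -> nat) :
  bounded_by M a -> bounded_by M b -> cfrac R a = cfrac R b -> a =1 b.
Proof.
move=> ha hb E j; elim: j a b ha hb E => [|j IH] a b ha hb E.
all: have [E0 E1] := cfrac_head_tail_inj ha hb E.
- exact: E0.
exact: (IH (fun j => a j.+1) (fun j => b j.+1) (bounded_by_shift 1 ha)
  (bounded_by_shift 1 hb) E1).
Qed.

Lemma cfrac_complete_quotients (R : realType) (M : nat) (a : nat -> nat) (j : nat) :
  bounded_by M a ->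
  cfrac R (fun i => a (j + i)%N) =
  (a j)%:R + (cfrac R (fun i => a (j.+1 + i)%N))^-1.
Proof.
move=> ha; rewrite (cfracS R (bounded_by_shift j ha)) addn0; congr (_ + (cfrac _ _)^-1).
by apply/funext => i; rewrite addnS.
Qed.

End CfracTheory.

(** * Upper bounds for Mahler's exponents *)

Section Exponent.
Local Open Scope classical_set_scope.
Local Open Scope ring_scope.

Lemma finite_bounded_polys (n B : nat) :
  finite_set [set P : {poly int} | (size P <= n)%N /\ (height P <= B)%N].
Proof.
(* Coefficients between [- B] and [B] are encoded after a shift by [B]. *)
pose f (v : {ffun 'I_n -> 'I_(2 * B).+1}) : {poly int} :=
  \poly_(j < n) (if insub j is Some i then (v i)%:Z - B%:Z else 0).
apply: (@sub_finite_set _ _ (f @` setT)); last exact/finite_image/finite_finset.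
move=> P /= [sP hP].
have hB j : (absz (P`_j)%R <= B)%N.
  have [jP|jP] := ltnP j (size P); last by rewrite nth_default.
  apply: leq_trans hP; exact: (leq_bigmax (Ordinal jP)).
exists [ffun i : 'I_n => inord (absz (P`_i + B%:Z)%R)] => //.
apply/polyP => j; rewrite coef_poly; case: ltnP => jn; last first.
  by rewrite nth_default // (leq_trans sP).
rewrite insubT ffunE /=; move: (P`_j) (hB j) => z hz.
rewrite inordK; lia.
Qed.

Lemma coef_le_height (R : realType) (P : {poly int}) (j : nat) :
  `|(P`_j)%:~R| <= (height P)%:R :> R.
Proof.
rewrite -intr_norm -abszE -pmulrn ler_nat.
have [jP|jP] := ltnP j (size P); last by rewrite nth_default.
exact: (leq_bigmax (Ordinal jP)).
Qed.

Lemma height_gt0 (P : {poly int}) : P != 0 -> (0 < height P)%N.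
Proof.
move=> P0; have h : ((size P).-1 < size P)%N by rewrite prednK ?size_poly_gt0.
apply: leq_trans (leq_bigmax (Ordinal h)) => /=.
by rewrite absz_gt0 -lead_coefE lead_coef_eq0.
Qed.

(** For [omega > D.+1], a good polynomial of height [h] satisfies [1 <= C * h ^ D / h ^ D.+1], so
    [h <= C], which leaves finitely many. *)
Lemma w_exp_le (R : realType) (n : nat) (xi : R) (C D : nat) :
  (forall P : {poly int}, (size P <= n.+1)%N -> eval_at P xi != 0 ->
     1 <= C%:R * (height P)%:R ^+ D * `|eval_at P xi|) ->
  (w_exp n xi <= (D.+1)%:R%:E)%E.
Proof.
move=> hP; apply: ge_ereal_sup => _ [omega infin <-]; rewrite lee_fin.
have [//|lt] := lerP omega D.+1%:R; case: infin.
apply: (sub_finite_set _ (finite_bounded_polys n.+1 C)) => P /= [sP P0 Pw].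
split=> //; have ePn0 : eval_at P xi != 0 by rewrite -normr_gt0.
have Pn0 : P != 0 by apply: contra_neq ePn0 => ->; rewrite /eval_at rmorph0 horner0.
have := hP P sP ePn0; have := height_gt0 Pn0; move: (height P) Pw => h Pw h0.
have hR : 1 <= h%:R :> R by rewrite ler1n.
have hp : 0 < h%:R :> R by lra.
have Pw' : `|eval_at P xi| <= (h%:R ^+ D.+1)^-1.
  apply: le_trans Pw _; rewrite powRN lef_pV2 ?posrE ?exprn_gt0 ?powR_gt0 //.
  by rewrite -powR_mulrn ?ler_powR // ?ltW.
move=> h1; rewrite -(ler_nat R).
have : 1 <= C%:R * h%:R ^+ D * (h%:R ^+ D.+1)^-1 :> R.
  by apply: le_trans h1 _; apply: ler_wpM2l => //; rewrite mulr_ge0 ?exprn_ge0.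
rewrite exprS invfM (mulrC (h%:R^-1)) mulrA mulfK ?expf_neq0 ?gt_eqF //.
by rewrite ler_pdivlMr // mul1r.
Qed.

Lemma eval_at_quadratic (R : realType) (P : {poly int}) (x : R) :
  (size P <= 3)%N ->
  eval_at P x = (P`_2)%:~R * x ^+ 2 + (P`_1)%:~R * x + (P`_0)%:~R.
Proof.
move=> sP; rewrite /eval_at (@horner_coef_wide _ 3); last first.
  exact: leq_trans (size_poly _ _) sP.
by rewrite !big_ord_recl big_ord0 !coef_map /=; ring.
Qed.

End Exponent.

(** * Lower bounds for quadratic polynomials along the periodic approximants *)

Section QuadraticApproximation.
Local Open Scope ring_scope.

Lemma cfrac_quadratic_lower_bound (R : realType) (a : nat -> nat) (M k p J : nat) :
  bounded_by M a -> (2 <= k)%N -> (0 < p)%N ->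
  (forall n t, (t < k ^ n)%N -> a (p * k ^ n + t)%N = a t) ->
  (forall s r, (r <= k ^ s)%N ->
     (forall j, (j < k ^ s * J)%N -> a (j + r)%N = a j) ->
     forall j, a (j + r)%N = a j) ->
  exists C D : nat, forall P : {poly int}, (size P <= 3)%N ->
    eval_at P (cfrac R a) != 0 ->
    1 <= C%:R * (height P)%:R ^+ D * `|eval_at P (cfrac R a)|.
Proof.
move=> ha k2 p0 hrep hper.
pose r n := (p * k ^ n)%N.
(* [w n] is the periodic word of alpha_n; [x] and [y n] are the complete quotients of xi and
   alpha_n. *)
pose w n j := a (j %% r n)%N.
pose x j := cfrac R (fun i => a (j + i)%N).
pose y n j := cfrac R (fun i => w n (j + i)%N).
have k0 : (0 < k)%N by lia.
have kn0 n : (0 < k ^ n)%N by rewrite expn_gt0 k0.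
have r0 n : (0 < r n)%N by rewrite muln_gt0 p0 kn0.
have hw n : bounded_by M (w n) by move=> j; apply: ha.
have a_gt0 j : (0 < a j)%N by case/andP: (ha j).
have wa n j : (j < r n + k ^ n)%N -> w n j = a j.
  move=> hj; rewrite /w; have [lt|ge] := ltnP j (r n); first by rewrite modn_small.
  have ht : (j - r n < k ^ n)%N by lia.
  rewrite -[in RHS](subnKC ge) hrep // -[in LHS](subnKC ge) modnDl modn_small //.
  by apply: leq_trans ht _; rewrite leq_pmull.
have yr n : y n (r n) = y n 0%N.
  by congr (cfrac R _); apply/funext => i; rewrite /w add0n modnDl.
pose m : R := M%:R + 1; pose rho : R := 1 + m^-1.
have m0 : 0 < m by rewrite ltr_wpDl.
have rho1 : 1 < rho by rewrite ltrDl invr_gt0.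
have hx j : rho <= x j <= m by apply: cfrac_bounds; apply: bounded_by_shift.
have hy n j : rho <= y n j <= m by apply: cfrac_bounds; apply: bounded_by_shift.
have y0 n j : 0 < y n j by have /andP[] := hy n j; lra.
have ex j : x j = (a j)%:R + (x j.+1)^-1 by exact: cfrac_complete_quotients.
have ey n j : (j < r n + k ^ n)%N -> y n j = (a j)%:R + (y n j.+1)^-1.
  by move=> hj; rewrite -(wa n) //; exact: (cfrac_complete_quotients R j (hw n)).
have ey' n j : (j < r n)%N -> y n j = (a j)%:R + (y n j.+1)^-1.
  by move=> hj; apply: ey; apply: ltn_addr.
(* The index is shifted because [r 0 = p] may be 1. *)
have r2 n : (2 <= r n.+1)%N.
  by rewrite /r expnS; have := kn0 n; nia.
(* The summand [p] gives [r n <= k ^ (n + p)]; the summand [J] gives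
   [r (n + N) >= k ^ (n + p) * J.+1], because [J < k ^ J]. *)
pose N := (p + J)%N.
have same n : y n 0%N = y (n + N)%N 0%N -> y n 0%N = x 0%N.
  move=> E; have wE := cfrac_inj (hw n) (hw (n + N)%N) E.
  (* One block more than the [J] needed by [hper] leaves room for the shift by [r n]. *)
  have Na j : (j < k ^ (n + p) * J.+1)%N -> w n j = a j.
    move=> hj; rewrite [LHS]wE; apply: wa; apply: leq_trans hj _.
    apply: leq_trans (leq_addr _ _); rewrite /r /N addnA [X in (_ <= _ * X)%N]expnD.
    apply: leq_trans (leq_pmull _ p0); rewrite leq_mul2l; apply/orP; right.
    exact: ltn_expl.
  have rs : (r n <= k ^ (n + p))%N.
    by rewrite /r expnD mulnC leq_mul2l; apply/orP; right; apply: ltnW; apply: ltn_expl.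
  have per : forall j, a (j + r n)%N = a j.
    apply: (hper _ _ rs) => j hj.
    rewrite -(Na (j + r n)%N) -?(Na j).
    - by rewrite /w modnDr.
    - by rewrite mulnS; lia.
    - by rewrite mulnS; lia.
  congr (cfrac R _); apply/funext => i; rewrite /w !add0n [in RHS](divn_eq i (r n)).
  elim: (i %/ r n)%N => [|q IH]; first by rewrite mul0n add0n.
  by rewrite mulSn -addnA addnC per.
have key n (b c d : int) (H : R) : 0 <= H ->
    `|b%:~R| <= H -> `|c%:~R| <= H -> `|d%:~R| <= H ->
    b%:~R * x 0%N ^+ 2 + c%:~R * x 0%N + d%:~R != 0 ->
    6%:R * (m * (2%:R * m + 1)) * H ^+ 2 <= rho ^+ (k ^ n.+1) ->
    1 <= 6%:R * H * m ^+ (2 * r (n.+1 + N)%N) *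
      `|b%:~R * x 0%N ^+ 2 + c%:~R * x 0%N + d%:~R|.
  move=> H0 hb hc hd Px big.
  (* Any level from [n] to [n + N] will do: the growth condition persists above [n], and the loss is
     at most that at level [n + N]. *)
  have good n' : b%:~R * y n'.+1 0%N ^+ 2 + c%:~R * y n'.+1 0%N + d%:~R != 0 ->
      (n <= n' <= n + N)%N ->
      1 <= 6%:R * H * m ^+ (2 * r (n.+1 + N)%N) *
        `|b%:~R * x 0%N ^+ 2 + c%:~R * x 0%N + d%:~R|.
    move=> Py /andP[le1 le2].
    have := @quadratic_value_lower_bound R a (r n'.+1) (r n'.+1 + k ^ n'.+1)%N x
      (y n'.+1) m rho H b c d a_gt0 (r2 n') (leq_addr _ _) (ltW rho1) hx (hy n'.+1)
      (fun j _ => ex j) (ey n'.+1) (yr n'.+1) H0 hb hc hd Py.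
    rewrite addKn => /(_ _)/le_trans -> //.
      apply: le_trans big _; apply: ler_weXn2l; first exact: ltW.
      by rewrite leq_exp2l.
    apply: ler_wpM2r => //; apply: ler_wpM2l; first by rewrite mulr_ge0.
    apply: ler_weXn2l; first by have /andP[] := hx 0%N; lra.
    by rewrite leq_mul2l leq_mul2l leq_exp2l // addSn ltnS le2 !orbT.
  have [Py1|Py1] := eqVneq (b%:~R * y n.+1 0%N ^+ 2 + c%:~R * y n.+1 0%N + d%:~R) 0;
    last by apply: (good n) => //; rewrite leqnn leq_addr.
  have [Py2|Py2] := eqVneq (b%:~R * y (n + N).+1 0%N ^+ 2
                              + c%:~R * y (n + N).+1 0%N + d%:~R) 0;
    last by apply: (good (n + N)%N) => //; rewrite leqnn leq_addr.
  have nz : [\/ b != 0, c != 0 | d != 0].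
    have [b0|] := eqVneq b 0; last by constructor 1.
    have [c0|] := eqVneq c 0; last by constructor 2.
    have [d0|] := eqVneq d 0; last by constructor 3.
    by move: Px; rewrite b0 c0 d0 !mul0r !addr0 eqxx.
  have E := purely_periodic_root_unique a_gt0 (r2 n) (y0 n.+1) (ey' n.+1) (yr n.+1)
    (y0 (n + N).+1 0%N) Py1 Py2 nz.
  by case/eqP: Px; rewrite -(same n.+1) ?addSn ?E.
(* The exponent [e] converts the loss, a power of [m], into a power of [rho] that the minimality of
   [n] controls. *)
have [e he] := expr_unbounded (m ^+ (2 * r N.+1)) rho1.
pose c1 : R := 6%:R * (m * (2%:R * m + 1)).
have m1 : 1 <= m by have /andP[] := hx 0%N; lra.
have c16 : 6%:R <= c1 by rewrite /c1; nra.
have rho2 : rho <= 2%:R.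
  have : m^-1 <= 1 by rewrite invf_le1.
  by rewrite /rho; lra.
pose C : R := 6%:R * c1 ^+ e.
exists (Num.bound C), (2 * e).+1 => P sP.
have -> : cfrac R a = x 0%N by [].
rewrite eval_at_quadratic // => Px.
set H : R := (height P)%:R.
have H1 : 1 <= H.
  rewrite ler1n; apply: height_gt0; apply: contra_neq Px => ->.
  by rewrite !coef0 !mul0r !addr0.
have H0 : 0 <= H by lra.
have ex_n : exists n, c1 * H ^+ 2 <= rho ^+ (k ^ n.+1).
  have [n hn] := expr_unbounded (c1 * H ^+ 2) rho1; exists n.
  apply: le_trans hn _; apply: ler_weXn2l; first exact: ltW.
  by apply: ltnW; apply: ltnW; apply: ltn_expl.
case: (ex_minnP ex_n) => n hn nmin.
have := key n P`_2 P`_1 P`_0 H H0 (coef_le_height R P 2) (coef_le_height R P 1)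
  (coef_le_height R P 0) Px hn.
move=> h; apply: le_trans h _; apply: ler_wpM2r => //.
have B1 : 1 <= c1 * H ^+ 2 by nra.
(* Minimality gives this for positive [n]; for [n = 0] it follows from [rho <= 2] and [6 <= c1]. *)
have below : rho ^+ (k ^ n) <= c1 * H ^+ 2.
  case: n nmin {hn} => [|n] nmin; first by rewrite expn0 expr1; nra.
  by have [//|/ltW/nmin] := lerP (rho ^+ (k ^ n.+1)) (c1 * H ^+ 2); rewrite ltnn.
have E : m ^+ (2 * r (n.+1 + N)%N) <= (c1 * H ^+ 2) ^+ e.
  have -> : (2 * r (n.+1 + N) = (2 * r N.+1) * k ^ n)%N.
    by rewrite /r -!mulnA -expnD addSnnS (addnC n).
  rewrite exprM; apply: (@le_trans _ _ ((rho ^+ e) ^+ (k ^ n))).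
    by apply: lerXn2r => //; rewrite nnegrE exprn_ge0 //; lra.
  by rewrite exprAC; apply: lerXn2r => //; rewrite nnegrE ?exprn_ge0 //; lra.
apply: (@le_trans _ _ (6%:R * H * (c1 * H ^+ 2) ^+ e)).
  by apply: ler_wpM2l => //; rewrite mulr_ge0.
have -> : 6%:R * H * (c1 * H ^+ 2) ^+ e = C * H ^+ (2 * e).+1.
  by rewrite exprMn -exprM exprS /C; ring.
apply: ler_wpM2r; first by rewrite exprn_ge0.
have C0 : 0 <= C by rewrite /C mulr_ge0 ?exprn_ge0 //; lra.
exact: ltW (archi_boundP C0).
Qed.

End QuadraticApproximation.

Theorem theorem11 (R : realType) (k : nat) (hk : (2 <= k)%N)
    (a : nat -> nat) (a_pos : forall n : nat, (0 < a n)%N)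
    (a_automatic : automatic k a)
    (I : finType) (sigma : I -> seq I) (i : I) (phi : I -> nat) (u : nat -> I)
    (sigma_uniform : uniform_morphism k sigma)
    (sigma_head : ohead (sigma i) = Some i)
    (u_limit : morphic_limit sigma i u)
    (phi_pos : forall x : I, (0 < phi x)%N)
    (a_eq : forall n : nat, a n = phi (u n))
    (i_twice : exists n m : nat, n <> m /\ u n = i /\ u m = i) :
  ~ U2_number (cfrac R a).
Proof.
have k0 : (0 < k)%N by apply: ltnW.
have ea : a = phi \o u by apply/funext.
have u_blocks := morphic_limit_block_determined k0 sigma_uniform u_limit.
(* Of two distinct occurrences of [i], at least one is at a positive position. *)
have [p p0 up] : exists2 p, (0 < p)%N & u p = u 0%N.
  rewrite (morphic_limit0 sigma_head u_limit).
  have [[|n] [m [nm [un um]]]] := i_twice; last by exists n.+1.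
  by exists m => //; case: m nm {um}.
have [J hJ] := periodic_of_long_prefix phi k0 u_blocks.
have ha : bounded_by (\max_(x : I) phi x) a.
  by move=> j; rewrite a_pos ea /=; exact: leq_bigmax.
have [n t ht||C [D hCD]] := @cfrac_quadratic_lower_bound R a _ k p J ha hk p0.
- by rewrite ea /= mulnC (u_blocks _ _ _ _ up ht) muln0.
- by rewrite ea => s r; apply: hJ.
(* The exponent [w_exp 2] is at most [D.+1], hence not infinite. *)
case=> w2 _; have := w_exp_le hCD.
by rewrite w2 leye_eq.
Qed.
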